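(* In the $k$-dimensional DRB game, for sufficiently large $n$, the navigable small-world equilibrium $\mathbf r\equiv k$ is reachable via best response dynamics from any non-zero strategy profile $\mathbf r\not\equiv 0$. Moreover, if all nodes move synchronously in the best response dynamics, then it takes at most $k\lfloor n/2\rfloor$ synchronous steps for any non-zero strategy profile to converge to the navigable small-world equilibrium $\mathbf r\equiv k$.
   Context: DRB (Distance-Reciprocity Balanced) game. Fix an integer $k\ge 1$ and $\gamma=1/g$ with $g\ge 2$ an integer. For an integer $n\ge 2$ let $V=\{1,\dots,n\}^k$, viewed as a torus grid with distance $d_M(u,v)=\sum_{i=1}^k\min\{|u_i-v_i|,\,n-|u_i-v_i|\}$. Each node $u\in V$ is a player with strategy $r_u\in\Sigma=\{0,\gamma,2\gamma,3\gamma,\dots\}$ and a constant exponent $\alpha_u>0$ (possibly different for different nodes). For $r\ge 0$ let $c(r)=\sum_{v\ne u}d_M(u,v)^{-r}$ (independent of $u$) and $p_u(v,r)=d_M(u,v)^{-r}/c(r)$ for $v\neq u$. The payoff of $u$ under the strategy profile $\mathbf r=(r_v)_{v\in V}$ is $$\pi_u(r_u,\mathbf r_{-u})=\Big(\sum_{v\ne u}p_u(v,r_u)\,d_M(u,v)\Big)^{\alpha_u}\Big(\sum_{v\ne u}p_u(v,r_u)\,p_v(u,r_v)\Big).$$ $\mathbf r\equiv s$ means $r_u=s$ for all $u\in V$. A strategy $r_u^*\in\Sigma$ is a best response to $\mathbf r_{-u}$ if $\pi_u(r_u^*,\mathbf r_{-u})\ge\pi_u(r_u,\mathbf r_{-u})$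 for all $r_u\in\Sigma$. Best response dynamics: in an asynchronous step, one player moves from its current strategy to its best response to the current strategy profile, the others staying put; in a synchronous step, every player moves from its current strategy to its best response to the current strategy profile. A profile is reachable via best response dynamics from another if some sequence of asynchronous steps leads from the latter to the former. A statement being true ''for sufficiently large $n$'' means that there exists a constant $n_0\in\mathbb N$, which may only depend on model constants such as $k$, $\gamma$ and $\alpha_u$, such that for all $n\ge n_0$ the statement is true in the grid with parameter $n$.
   Formalization: The exponents α_u are assumed to lie in a fixed interval [a,b] with a>0, on which n_0 depends together with k and γ; with exponents unbounded as n grows (e.g. k=1, α_u=u) the claim fails, since r≡k is then not an equilibrium. *)

(* Defs.v *)
From HB Require Import structures.
From Stdlib Require Import Relations.Relation_Operators.
From mathcomp Require Import all_boot all_order all_algebra.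
From mathcomp Require Import classical_sets reals exp.

Set Implicit Arguments.
Unset Strict Implicit.
Unset Printing Implicit Defensive.

Import Order.TTheory GRing.Theory Num.Theory.

Local Open Scope classical_set_scope.
Local Open Scope ring_scope.

(* Coordinates run over 0..n-1 instead of 1..n; only the differences of
   coordinates matter. *)
Definition node (k n : nat) : finType := {ffun 'I_k -> 'I_n}.

Definition torus_dist (k n : nat) (u v : node k n) : nat :=
  (\sum_(i < k) minn `|u i - v i| (n - `|u i - v i|))%N.

(* The value of [norm_const u r] does not depend on [u], since the torus is
   translation invariant. *)
Definition norm_const (R : realType) (k n : nat) (u : node k n) (r : R) : R :=
  \sum_(v | v != u) (torus_dist u v)%:R `^ (- r).

Definition link_prob (R : realType) (k n : nat) (u v : node k n) (r : R) : R :=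
  (torus_dist u v)%:R `^ (- r) / norm_const u r.

Definition profile (R : realType) (k n : nat) := {ffun node k n -> R}.

Definition const_profile (R : realType) (k n : nat) (s : R) : profile R k n :=
  [ffun => s].

Arguments const_profile {R} k n s.

(* The strategy set {0, gamma, 2 gamma, ...} with gamma = 1 / g. *)
Definition strategies (R : realType) (g : nat) : set R :=
  range (fun m : nat => m%:R * g%:R^-1).

(* Payoff of [u] when it plays [s] and every other node [v] plays [r v]; the
   entry [r u] is not used. *)
Definition payoff (R : realType) (k n : nat) (alpha : node k n -> R)
    (r : profile R k n) (u : node k n) (s : R) : R :=
  (\sum_(v | v != u) link_prob u v s * (torus_dist u v)%:R) `^ alpha u *
  (\sum_(v | v != u) link_prob u v s * link_prob v u (r v)).

Definition best_response (R : realType) (g k n : nat) (alpha : node k n -> R)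
    (r : profile R k n) (u : node k n) (s : R) : Prop :=
  strategies g s /\
  forall s' : R, strategies g s' -> payoff alpha r u s' <= payoff alpha r u s.

Definition async_step (R : realType) (g k n : nat) (alpha : node k n -> R)
    (r r' : profile R k n) : Prop :=
  exists u : node k n,
    best_response g alpha r u (r' u) /\ forall v, v != u -> r' v = r v.

Definition reachable (R : realType) (g k n : nat) (alpha : node k n -> R)
    (r r' : profile R k n) : Prop :=
  clos_refl_trans (profile R k n) (async_step g alpha) r r'.

(* Best responses need not be unique a priori: a step may use any of them. *)
Definition sync_step (R : realType) (g k n : nat) (alpha : node k n -> R)
    (r r' : profile R k n) : Prop :=
  forall u : node k n, best_response g alpha r u (r' u).

Definition sync_dynamics (R : realType) (g k n : nat) (alpha : node k n -> R)
    (r0 : profile R k n) (s : nat -> profile R k n) : Prop :=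
  s 0%N = r0 /\ forall t : nat, sync_step g alpha (s t) (s t.+1).

Definition converges_within (R : realType) (k n : nat)
    (s : nat -> profile R k n) (r : profile R k n) (T : nat) : Prop :=
  exists2 t : nat, (t <= T)%N & forall t' : nat, (t <= t')%N -> s t' = r.

(* Main.v *)
(* For large n, two facts about a player u hold whatever the other players do.
   First, every strategy above k loses to k: it shortens the mean link by a power
   of n, while the reciprocity term gains at most the factor c(k), which is
   smaller than any power of n.  Hence the best response is attained among the
   finitely many strategies up to k.  Second, if some node v at distance at most 2
   from u links back to u with probability at least a constant times 1/c(gamma),
   then every strategy s < k also loses to k.  Indeed, targets at distance at most
   n^(1-d) contribute to the reciprocity at s less than n^(-d*gamma) c(k) times
   what they contribute at k; a farther target links back with probability at most
   n^(-k(1-d)) up to a constant, which is negligible against the contribution of v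
   to the reciprocity at k.

   The link back from v is strong enough when v is a neighbor of u with non-zero
   strategy, or when v plays k at distance at most 2.  So from a non-zero node v
   the strategy k spreads to the neighbors of v in one synchronous step; after two
   steps it fills the ball of radius 2 around v, and from then on the ball grows by
   1 per step until it covers the torus, whose diameter is at most k * floor(n/2). *)

Require Import Defs.
From HB Require Import structures.
From Stdlib Require Import Relations.Relation_Operators.
From mathcomp Require Import all_boot all_order all_algebra zify ring lra.
From mathcomp Require Import classical_sets reals exp.

Set Implicit Arguments.
Unset Strict Implicit.
Unset Printing Implicit Defensive.

Import Order.TTheory GRing.Theory Num.Theory.

Local Open Scope classical_set_scope.
Local Open Scope ring_scope.

(** * Geometry of the torus *)

Definition cycle_dist (n : nat) (x y : 'I_n) : nat :=
  minn `|x - y| (n - `|x - y|).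

Lemma torus_distE (k n : nat) (u v : node k n) :
  torus_dist u v = (\sum_(i < k) cycle_dist (u i) (v i))%N.
Proof. by []. Qed.

Section CycleDist.
Variable n : nat.
Implicit Types x y z : 'I_n.

Lemma cycle_distC x y : cycle_dist x y = cycle_dist y x.
Proof. by rewrite /cycle_dist; lia. Qed.

Lemma cycle_distxx x : cycle_dist x x = 0%N.
Proof. by rewrite /cycle_dist; lia. Qed.

Lemma cycle_dist_gt0 x y : x != y -> (0 < cycle_dist x y)%N.
Proof.
move/eqP=> xy; have {}xy : nat_of_ord x <> y by move=> e; apply/xy/val_inj.
by have := ltn_ord x; have := ltn_ord y; rewrite /cycle_dist; lia.
Qed.

Lemma cycle_dist_half x y : (cycle_dist x y <= n./2)%N.
Proof. by have := ltn_ord x; have := ltn_ord y; rewrite /cycle_dist; lia. Qed.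

Lemma cycle_dist_triangle y x z :
  (cycle_dist x z <= cycle_dist x y + cycle_dist y z)%N.
Proof.
have := ltn_ord x; have := ltn_ord y; have := ltn_ord z.
by rewrite /cycle_dist; lia.
Qed.

Lemma val_ordS x : nat_of_ord (ordS x) = if x.+1 == n then 0%N else x.+1.
Proof.
have /= := ltn_ord x; case: eqP => [-> _|xn lt_xn]; first by rewrite modnn.
by rewrite modn_small; lia.
Qed.

Lemma val_ord_pred x :
  nat_of_ord (ord_pred x) = if nat_of_ord x == 0%N then n.-1 else x.-1.
Proof.
have /= := ltn_ord x; case: eqP => [-> n0|x0 lt_xn].
  by rewrite add0n modn_small; lia.
have -> : ((x + n).-1 = x.-1 + n)%N by lia.
by rewrite modnDr modn_small; lia.
Qed.

Lemma cycle_dist_ordS x : (2 <= n)%N -> cycle_dist x (ordS x) = 1%N.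
Proof.
move=> n2; have := ltn_ord x; rewrite /cycle_dist val_ordS.
by case: eqP; lia.
Qed.

Lemma cycle_dist_ord_pred x : (2 <= n)%N -> cycle_dist x (ord_pred x) = 1%N.
Proof.
move=> n2; have := ltn_ord x; rewrite /cycle_dist val_ord_pred.
by case: eqP; lia.
Qed.

Lemma ordS_neq_pred x : (3 <= n)%N -> ordS x != ord_pred x.
Proof.
move=> n3; apply/eqP => /(congr1 val) /= e; have := val_ordS x.
by have := val_ord_pred x; rewrite /= e; have := ltn_ord x; do 2!case: eqP; lia.
Qed.

Lemma cycle_dist_step x z : x != z ->
  exists2 y, cycle_dist x y = 1%N & (cycle_dist z y).+1 = cycle_dist z x.
Proof.
move/eqP=> xz; have {}xz : nat_of_ord x <> z by move=> e; apply/xz/val_inj.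
have x_n := ltn_ord x; have z_n := ltn_ord z.
have n2 : (2 <= n)%N by lia.
have [near|far] := leqP (cycle_dist z x) (cycle_dist z (ordS x)).
  exists (ord_pred x); first exact: cycle_dist_ord_pred.
  move: near; rewrite /cycle_dist val_ordS val_ord_pred.
  by do 2!case: eqP; lia.
exists (ordS x); first exact: cycle_dist_ordS.
by move: far; rewrite /cycle_dist val_ordS; case: eqP; lia.
Qed.

End CycleDist.

Section TorusDist.
Variables k n : nat.
Implicit Types u v w : node k n.

Lemma torus_distC u v : torus_dist u v = torus_dist v u.
Proof. by apply: eq_bigr => i _; exact: cycle_distC. Qed.

Lemma torus_distxx u : torus_dist u u = 0%N.
Proof. by apply: big1 => i _; exact: cycle_distxx. Qed.

Lemma torus_dist_gt0 u v : u != v -> (0 < torus_dist u v)%N.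
Proof.
move=> uv; have /existsP[i uvi] : [exists i, u i != v i].
  apply: contraNT uv; rewrite negb_exists => /forallP eq_uv.
  by apply/eqP/ffunP => i; apply/eqP; rewrite -[_ == _]negbK eq_uv.
rewrite torus_distE (bigD1 i) //= addn_gt0; apply/orP; left.
exact: cycle_dist_gt0.
Qed.

Lemma torus_dist_le u v : (torus_dist u v <= k * n./2)%N.
Proof.
rewrite torus_distE -[X in (_ <= X * _)%N]card_ord -sum_nat_const.
by apply: leq_sum => i _; exact: cycle_dist_half.
Qed.

Lemma torus_dist_triangle v u w :
  (torus_dist u w <= torus_dist u v + torus_dist v w)%N.
Proof.
rewrite !torus_distE -big_split /=.
by apply: leq_sum => i _; exact: cycle_dist_triangle.
Qed.

Lemma cycle_dist_le_torus_dist u v i :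
  (cycle_dist (u i) (v i) <= torus_dist u v)%N.
Proof. by rewrite torus_distE (bigD1 i) //= leq_addr. Qed.

Definition set_coord u (i : 'I_k) (x : 'I_n) : node k n :=
  [ffun j => if j == i then x else u j].

Lemma torus_dist_set_coord v u i x :
  (torus_dist v (set_coord u i x) + cycle_dist (v i) (u i) =
   torus_dist v u + cycle_dist (v i) x)%N.
Proof.
rewrite !torus_distE (bigD1 i) //= [in RHS](bigD1 i) //= ffunE eqxx.
have -> : (\sum_(j < k | j != i) cycle_dist (v j) (set_coord u i x j) =
           \sum_(j < k | j != i) cycle_dist (v j) (u j))%N.
  by apply: eq_bigr => j /negbTE ji; rewrite ffunE ji.
by rewrite addnAC [in RHS]addnAC [(cycle_dist _ x + _)%N]addnC.
Qed.

Lemma torus_dist_step v w : w != v ->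
  exists2 w', torus_dist w w' = 1%N & (torus_dist v w').+1 = torus_dist v w.
Proof.
move=> wv; have /existsP[i wvi] : [exists i, w i != v i].
  apply: contraNT wv; rewrite negb_exists => /forallP eq_wv.
  by apply/eqP/ffunP => i; apply/eqP; rewrite -[_ == _]negbK eq_wv.
have [y wy vy] := cycle_dist_step wvi; exists (set_coord w i y).
  have := torus_dist_set_coord w w i y.
  by rewrite torus_distxx cycle_distxx addn0 add0n wy.
by have := torus_dist_set_coord v w i y; lia.
Qed.

Hypotheses (k_gt0 : (0 < k)%N).

Lemma ex_neighbor u : (2 <= n)%N -> exists v, torus_dist u v = 1%N.
Proof.
move=> n2; pose i := Ordinal k_gt0; exists (set_coord u i (ordS (u i))).
have := torus_dist_set_coord u u i (ordS (u i)).
by rewrite torus_distxx cycle_distxx addn0 add0n cycle_dist_ordS.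
Qed.

Lemma ex_other_neighbor u v : (3 <= n)%N ->
  exists w, [/\ w != u, torus_dist v w = 1%N
              & (torus_dist u w <= torus_dist u v + 1)%N].
Proof.
move=> n3; pose i := Ordinal k_gt0.
have dS : torus_dist v (set_coord v i (ordS (v i))) = 1%N.
  have := torus_dist_set_coord v v i (ordS (v i)).
  by rewrite torus_distxx cycle_distxx addn0 add0n cycle_dist_ordS //; lia.
have dP : torus_dist v (set_coord v i (ord_pred (v i))) = 1%N.
  have := torus_dist_set_coord v v i (ord_pred (v i)).
  by rewrite torus_distxx cycle_distxx addn0 add0n cycle_dist_ord_pred //; lia.
have [eq_u|neq_u] := eqVneq (set_coord v i (ordS (v i))) u; last first.
  exists (set_coord v i (ordS (v i))).
  by split=> //; rewrite -dS torus_dist_triangle.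
exists (set_coord v i (ord_pred (v i))); split=> //; last first.
  by rewrite -dP torus_dist_triangle.
apply/eqP => eq_u'; have := ordS_neq_pred (v i) n3.
by move: eq_u; rewrite -eq_u' => /ffunP/(_ i); rewrite !ffunE eqxx => ->; rewrite eqxx.
Qed.

End TorusDist.

(** * Power sums along a cycle *)

Section CycleSum.
Variable R : realType.
Implicit Types t p x : R.

Lemma powR_bernoulli x p : 0 <= x -> 0 < p < 1 -> x `^ p <= p * x + (1 - p).
Proof.
move=> x0 /andP[p0 p1].
have q0 : 0 < 1 - p by rewrite subr_gt0.
have := @conjugate_powR R (x `^ p) 1 p^-1 (1 - p)^-1 (powR_ge0 _ _) ler01.
rewrite !invr_gt0 !invrK -powRrM divff ?gt_eqF // powRr1 // powR1 mulr1 mul1r.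
by rewrite [x * p]mulrC => -> //; ring.
Qed.

Lemma sum_powR_le t (n : nat) : 0 < t < 1 ->
  \sum_(1 <= j < n.+1) (j%:R : R) `^ (- t) <= n%:R `^ (1 - t) / (1 - t).
Proof.
move=> /andP[t0 t1]; have p0 : 0 < 1 - t by rewrite subr_gt0.
elim: n => [|n IHn].
  by rewrite big_geq // divr_ge0 ?powR_ge0 // ltW.
rewrite big_nat_recr //=; apply: (le_trans (lerD IHn (lexx _))).
have n1_gt0 : 0 < n.+1%:R :> R by rewrite ltr0n.
have n1_neq0 : n.+1%:R != 0 :> R by rewrite gt_eqF.
have -> : (n.+1%:R : R) `^ (- t) = n.+1%:R `^ (1 - t) / n.+1%:R.
  rewrite -[X in _ / X]powRr1 ?ltW // -powRB ?n1_neq0 ?implybT //.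
  by congr (_ `^ _); ring.
have -> : n%:R = n.+1%:R * (n%:R / n.+1%:R) :> R by rewrite mulrC divfK.
rewrite powRM ?divr_ge0 ?ler0n //.
have q01 : 0 < 1 - t < 1 by rewrite p0 /= ltrBlDr ltrDl.
have := powR_bernoulli (divr_ge0 (ler0n R n) (ler0n R n.+1)) q01.
have -> : n%:R / n.+1%:R = 1 - n.+1%:R^-1 :> R.
  by apply: (mulIf n1_neq0); rewrite divfK // mulrBl mulVf // mul1r -natr1 addrK.
set P := n.+1%:R `^ (1 - t); set Q := (1 - _) `^ _ => le_Q.
have P0 : 0 <= P by exact: powR_ge0.
rewrite ler_pdivlMr // mulrDl divfK ?gt_eqF //.
apply: (le_trans (lerD (ler_wpM2l P0 le_Q) (lexx _))).
by rewrite le_eqVlt; apply/orP; left; apply/eqP; ring.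
Qed.

Lemma cycle_dist_sub (n : nat) (w x : 'I_n.+1) :
  cycle_dist w x = (x - w)%R :> nat \/ cycle_dist w x = (w - x)%R :> nat.
Proof.
have := ltn_ord w; have := ltn_ord x; rewrite /cycle_dist /=.
have modE y : (y < n.+1)%N -> ((n.+1 - y) %% n.+1 = if y == 0 then 0 else n.+1 - y)%N.
  by case: eqP => [->|y0] y_n; rewrite ?subn0 ?modnn // modn_small; lia.
move=> x_n w_n; rewrite !modE //.
have addE y z : (y < n.+1)%N -> (z < n.+1)%N ->
    ((y + z) %% n.+1 = if y + z < n.+1 then y + z else y + z - n.+1)%N.
  move=> y_n z_n; case: ltnP => yz; first by rewrite modn_small.
  by rewrite -{1}(subnK yz) modnDr modn_small; lia.
rewrite !addE //; last 2 first.
- by case: eqP; lia.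
- by case: eqP; lia.
by do !case: ifP; lia.
Qed.

Lemma sum_cycle_dist_le t (n : nat) (w : 'I_n) : 0 < t < 1 ->
  \sum_(x < n) ((maxn 1 (cycle_dist w x))%:R : R) `^ (- t) <=
  2 * (1 + (1 - t)^-1) * n%:R `^ (1 - t).
Proof.
case: n w => [[]//|n] w t01; have /andP[t0 t1] := t01.
pose F (j : nat) := ((maxn 1 j)%:R : R) `^ (- t).
have sumF : \sum_(x < n.+1) F x <= (1 + (1 - t)^-1) * n.+1%:R `^ (1 - t).
  rewrite big_ord_recl {1}/F /= powR1 mulrDl mul1r mulrC.
  have n1_ge1 : 1 <= n.+1%:R :> R by rewrite ler1n.
  apply: lerD; first by rewrite -[leLHS](powRr0 n.+1%:R) ler_powR // subr_ge0 ltW.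
  apply: le_trans (_ : n%:R `^ (1 - t) / (1 - t) <= _).
    apply: le_trans (sum_powR_le n t01).
    rewrite big_add1 /= big_mkord; apply: ler_sum => j _.
    by rewrite /F /bump /= add1n (maxn_idPr _).
  apply: ler_wpM2r; first by rewrite invr_ge0 subr_ge0 ltW.
  by apply: ge0_ler_powR; rewrite ?nnegrE ?ler0n ?ler_nat // subr_ge0 ltW.
apply: le_trans (_ : \sum_(x < n.+1) (F (x - w)%R + F (w - x)%R) <= _).
  apply: ler_sum => x _.
  case: (cycle_dist_sub w x) => ->; first by rewrite lerDl powR_ge0.
  by rewrite lerDr powR_ge0.
rewrite big_split -mulrA mulr_natl mulr2n; apply: lerD.
  rewrite (reindex_inj (addIr w)).
  by under eq_bigr => x _ do rewrite addrK.
have subK : involutive (fun x : 'I_n.+1 => w - x).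
  by move=> x; rewrite opprB addrC subrK.
rewrite (reindex_inj (inv_inj subK)).
by under eq_bigr => x _ do rewrite subK.
Qed.

End CycleSum.

(** * Normalizing constants and link probabilities *)

Section NormConst.
Variables (R : realType) (k n : nat).
Implicit Types (u v w : node k n) (s : R).

Lemma torus_dist_ge1 u v : v != u -> 1 <= (torus_dist u v)%:R :> R.
Proof. by move=> vu; rewrite ler1n torus_dist_gt0 // eq_sym. Qed.

Lemma powR_torus_dist_gt0 u v s : v != u -> 0 < (torus_dist u v)%:R `^ s :> R.
Proof. by move=> vu; rewrite powR_gt0 // (lt_le_trans ltr01) // torus_dist_ge1. Qed.

Lemma norm_const_anti u s s' : s <= s' -> norm_const u s' <= norm_const u s.
Proof.
move=> ss'; apply: ler_sum => v vu; apply: ler_powR; first exact: torus_dist_ge1.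
by rewrite lerN2.
Qed.

Lemma le_norm_const u v s : v != u ->
  (torus_dist u v)%:R `^ (- s) <= norm_const u s :> R.
Proof.
move=> vu; rewrite /norm_const (bigD1 v) //= lerDl sumr_ge0 // => w _.
exact: powR_ge0.
Qed.

Lemma card_node : #|node k n| = (n ^ k)%N.
Proof. by rewrite card_ffun !card_ord. Qed.

Lemma norm_const_ge s u : (0 < k)%N -> (2 <= n)%N -> 0 <= s <= k%:R ->
  n%:R `^ (k%:R - s) <= 2 * k%:R ^+ k * norm_const u s.
Proof.
move=> k0 n2 /andP[s0 sk]; have n0 : 0 < n%:R :> R by rewrite ltr0n; lia.
have kR : 1 <= k%:R :> R by rewrite ler1n.
have kn0 : 0 < k%:R * n%:R :> R by rewrite mulr_gt0 // ltr0n.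
have cardD1 : (n ^ k <= 2 * #|[pred v | v != u]|)%N.
  have := cardC1 u; rewrite card_node => ->.
  by have : (n ^ 1 <= n ^ k)%N; [rewrite leq_exp2l|rewrite expn1; lia].
have ge_term v : v != u ->
    (k%:R * n%:R) `^ (- s) <= (torus_dist u v)%:R `^ (- s) :> R.
  move=> vu; rewrite !powRN lef_pV2 ?posrE ?powR_gt0 //; last first.
    by rewrite ltr0n torus_dist_gt0 // eq_sym.
  apply: ge0_ler_powR; rewrite ?nnegrE ?ler0n ?(ltW kn0) //.
  rewrite -natrM ler_nat; apply: leq_trans (torus_dist_le u v) _.
  by rewrite leq_mul2l; apply/orP; right; lia.
have : #|[pred v | v != u]|%:R * (k%:R * n%:R) `^ (- s) <= norm_const u s.
  by rewrite mulr_natl -sumr_const; apply: ler_sum => v; exact: ge_term.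
rewrite -(@ler_pM2l _ (2 * k%:R ^+ k)) ?mulr_gt0 ?exprn_gt0 ?ltr0n //.
apply: le_trans.
rewrite powRM ?ler0n // powRB ?(gt_eqF n0) ?implybT // (powR_mulrn k (ler0n R n)).
rewrite [n%:R `^ (- s)]powRN.
have -> : 2 * k%:R ^+ k * (#|[pred v | v != u]|%:R * (k%:R `^ (- s) / n%:R `^ s)) =
   (k%:R ^+ k * k%:R `^ (- s)) * (2 * #|[pred v | v != u]|%:R) / n%:R `^ s :> R.
  by ring.
have cardR : n%:R ^+ k <= 2 * #|[pred v | v != u]|%:R :> R.
  by rewrite -natrX -natrM ler_nat.
rewrite ler_pM2r ?invr_gt0 ?powR_gt0 // -[leLHS]mul1r.
apply: ler_pM => //; first by rewrite exprn_ge0 ?ler0n.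
rewrite -(powR_mulrn k (ler0n R k)) -powRD ?(gt_eqF (lt_le_trans ltr01 kR)) ?implybT //.
by rewrite -[leLHS](powRr0 k%:R) ler_powR // subr_ge0.
Qed.

Lemma norm_const_le s u : (0 < k)%N -> 0 < s < k%:R ->
  norm_const u s <=
  (2 * (1 + (1 - s / k%:R)^-1)) ^+ k * n%:R `^ (k%:R - s).
Proof.
move=> k0 /andP[s0 sk]; have kR : 0 < k%:R :> R by rewrite ltr0n.
pose t := s / k%:R; have t01 : 0 < t < 1.
  by rewrite divr_gt0 //= ltr_pdivrMr // mul1r.
pose F (i : 'I_k) (x : 'I_n) : R := (maxn 1 (cycle_dist (u i) x))%:R `^ (- t).
apply: le_trans (_ : \prod_(i < k) \sum_(x < n) F i x <= _).
  rewrite bigA_distr_bigA /=.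
  apply: le_trans (_ : \sum_(v | v != u) \prod_(i < k) F i (v i) <= _).
    apply: ler_sum => v vu.
    have -> : (torus_dist u v)%:R `^ (- s) =
        \prod_(i < k) (torus_dist u v)%:R `^ (- t) :> R.
      rewrite prodr_const card_ord -powR_mulrn ?powR_ge0 // -powRrM.
      by rewrite mulNr divfK ?gt_eqF.
    apply: ler_prod => i _; rewrite powR_ge0 /= /F !powRN.
    have d1 : (0 < torus_dist u v)%N by rewrite torus_dist_gt0 // eq_sym.
    rewrite lef_pV2 ?posrE ?powR_gt0 ?ltr0n ?leq_max //.
    apply: ge0_ler_powR; rewrite ?nnegrE ?ler0n ?ler_nat ?(ltW (andP t01).1) //.
    by rewrite geq_max d1 cycle_dist_le_torus_dist.
  rewrite [leRHS](bigID (fun v => v != u)) /= lerDl.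
  by apply: sumr_ge0 => v _; apply: prodr_ge0 => i _; exact: powR_ge0.
have -> : n%:R `^ (k%:R - s) = (n%:R `^ (1 - t)) ^+ k :> R.
  rewrite -powR_mulrn ?powR_ge0 // -powRrM; congr (_ `^ _).
  by rewrite mulrBl mul1r divfK ?gt_eqF.
rewrite -exprMn -[X in _ ^+ X](card_ord k) -prodr_const; apply: ler_prod => i _.
rewrite sum_cycle_dist_le // andbT; apply: sumr_ge0 => x _; exact: powR_ge0.
Qed.

End NormConst.

Section LinkProb.
Variables (R : realType) (k n : nat).
Hypotheses (k_gt0 : (0 < k)%N) (n_ge2 : (2 <= n)%N).
Implicit Types (u v w : node k n) (s : R).

Lemma norm_const_ge1 u s : 1 <= norm_const u s.
Proof.
have [v uv] := ex_neighbor k_gt0 u n_ge2.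
have vu : v != u by apply: contra_eqN uv => /eqP ->; rewrite torus_distxx.
by have := le_norm_const s vu; rewrite uv powR1.
Qed.

Lemma norm_const_gt0 u s : 0 < norm_const u s.
Proof. exact: lt_le_trans (norm_const_ge1 u s). Qed.

Lemma link_prob_ge0 u v s : 0 <= link_prob u v s.
Proof. by rewrite divr_ge0 ?powR_ge0 // ltW // norm_const_gt0. Qed.

Lemma sum_link_prob u s : \sum_(v | v != u) link_prob u v s = 1.
Proof. by rewrite -mulr_suml divff // gt_eqF // norm_const_gt0. Qed.

Lemma mean_dist u s :
  \sum_(v | v != u) link_prob u v s * (torus_dist u v)%:R =
  norm_const u (s - 1) / norm_const u s.
Proof.
rewrite mulr_suml; apply: eq_bigr => v vu.
have d0 : 0 < (torus_dist u v)%:R :> R by rewrite (lt_le_trans ltr01) // torus_dist_ge1.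
rewrite /link_prob mulrAC opprB [1 - s]addrC powRD ?(gt_eqF d0) ?implybT //.
by rewrite powRr1 // ltW.
Qed.

Lemma mean_dist_le u s :
  \sum_(v | v != u) link_prob u v s * (torus_dist u v)%:R <= k%:R * n%:R.
Proof.
rewrite -[leRHS]mul1r -[X in _ <= X * _](sum_link_prob u s) mulr_suml.
apply: ler_sum => v _; rewrite ler_wpM2l ?link_prob_ge0 // -natrM ler_nat.
apply: leq_trans (torus_dist_le u v) _.
by rewrite leq_mul2l; apply/orP; right; lia.
Qed.

Lemma card_torus_ball u (L : nat) : (2 * L <= n)%N ->
  (L.+1 ^ k <= #|[set v | (torus_dist u v <= k * L)%N]%SET|)%N.
Proof.
move=> Ln.
pose shift (x : 'I_n) (j : 'I_L.+1) : 'I_n :=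
  insubd x (if (x + j < n)%N then x + j else x - j)%N.
have shiftE x j : nat_of_ord (shift x j) = (if (x + j < n)%N then x + j else x - j)%N.
  by rewrite val_insubd; have := ltn_ord x; do !case: ifP; lia.
pose h (f : {ffun 'I_k -> 'I_L.+1}) : node k n := [ffun i => shift (u i) (f i)].
have h_inj : injective h.
  move=> f f' /ffunP hf; apply/ffunP => i; apply/val_inj => /=.
  have := congr1 (@nat_of_ord n) (hf i); rewrite !ffunE !shiftE.
  have := ltn_ord (f i); have := ltn_ord (f' i); have := ltn_ord (u i).
  by do !case: ifP; lia.
have -> : (L.+1 ^ k = #|[set h f | f : {ffun 'I_k -> 'I_L.+1}]%SET|)%N.
  by rewrite card_imset // card_ffun !card_ord.
apply/subset_leq_card/fintype.subsetP => _ /imsetP[f _ ->]; rewrite inE torus_distE.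
rewrite -[X in (_ <= X * _)%N](card_ord k) -sum_nat_const; apply: leq_sum => i _.
rewrite ffunE /cycle_dist shiftE geq_min; apply/orP; left.
have := ltn_ord (f i); have := ltn_ord (u i).
move: (nat_of_ord (u i)) (nat_of_ord (f i)) => x j.
by case: ifP => _ x_n j_L; lia.
Qed.

Lemma link_prob_far u w s (L : nat) : 0 <= s -> (0 < L)%N -> (2 * L <= n)%N ->
  (k * L < torus_dist w u)%N -> link_prob w u s <= (L%:R ^+ k)^-1.
Proof.
move=> s0 L0 Ln far; set d := torus_dist w u in far *.
have d0 : 0 < d%:R `^ (- s) :> R by rewrite powR_gt0 // ltr0n; lia.
rewrite ler_pdivrMr ?norm_const_gt0 // mulrC ler_pdivlMr ?exprn_gt0 ?ltr0n //.
pose B := [set v | (torus_dist w v <= k * L)%N]%SET.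
have cardB : (L ^ k <= #|B :\ w|)%N.
  have := card_torus_ball w Ln; rewrite -/B.
  rewrite (cardsD1 w B) inE torus_distxx leq0n add1n => ball.
  by rewrite -ltnS; apply: leq_trans ball; rewrite ltn_exp2r.
rewrite mulrC -natrX; apply: le_trans (_ : #|B :\ w|%:R * d%:R `^ (- s) <= _).
  by rewrite ler_pM2r // ler_nat.
rewrite mulr_natl -sumr_const.
apply: le_trans (_ : \sum_(v in B :\ w) (torus_dist w v)%:R `^ (- s) <= _).
  apply: ler_sum => v; rewrite !inE => /andP[vw dv].
  have wv0 : (0 < torus_dist w v)%N by rewrite torus_dist_gt0 // eq_sym.
  have wu0 : (0 < d)%N by lia.
  rewrite !powRN lef_pV2 ?posrE ?powR_gt0 ?ltr0n //.
  by apply: ge0_ler_powR; rewrite ?nnegrE ?ler0n // ler_nat; lia.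
rewrite /norm_const [leRHS](bigID (fun v => v \in B)) /=.
rewrite (eq_bigl (fun v => (v != w) && (v \in B))) => [|v]; last by rewrite !inE.
by rewrite lerDl sumr_ge0 // => v _; exact: powR_ge0.
Qed.

End LinkProb.

(** * Reciprocity *)

Section Payoff.
Variables (R : realType) (k n : nat).
Hypotheses (k_gt0 : (0 < k)%N) (n_ge2 : (2 <= n)%N).
Implicit Types (u v w : node k n) (s : R) (r : profile R k n).

Definition mean_link u s : R :=
  \sum_(v | v != u) link_prob u v s * (torus_dist u v)%:R.

Definition reciprocity r u s : R :=
  \sum_(v | v != u) link_prob u v s * link_prob v u (r v).

Lemma link_prob_gt0 u v s : v != u -> 0 < link_prob u v s.
Proof.
by move=> vu; rewrite divr_gt0 ?powR_torus_dist_gt0 ?norm_const_gt0.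
Qed.

Lemma reciprocity_ge_link r u v s : v != u ->
  link_prob u v s * link_prob v u (r v) <= reciprocity r u s.
Proof.
move=> vu; rewrite /reciprocity (bigD1 v) //= lerDl sumr_ge0 // => w _.
by rewrite mulr_ge0 ?link_prob_ge0.
Qed.

Lemma reciprocity_gt0 r u s : 0 < reciprocity r u s.
Proof.
have [v uv] := ex_neighbor k_gt0 u n_ge2.
have vu : v != u by apply: contra_eqN uv => /eqP ->; rewrite torus_distxx.
apply: lt_le_trans (reciprocity_ge_link r s vu).
by rewrite mulr_gt0 ?link_prob_gt0 // eq_sym.
Qed.

Lemma reciprocity_le_above r u s s' : s <= s' ->
  reciprocity r u s' <= norm_const u s * reciprocity r u s.
Proof.
move=> ss'; rewrite mulr_sumr; apply: ler_sum => v vu.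
rewrite mulrA ler_wpM2r ?link_prob_ge0 //.
have -> : norm_const u s * link_prob u v s = (torus_dist u v)%:R `^ (- s).
  by rewrite /link_prob mulrC divfK // gt_eqF // norm_const_gt0.
rewrite ler_pdivrMr ?norm_const_gt0 // -[leLHS]mulr1.
apply: ler_pM; rewrite ?powR_ge0 ?ler01 ?norm_const_ge1 //.
by apply: ler_powR; rewrite ?torus_dist_ge1 // lerN2.
Qed.

(* Targets within distance [k * L] are controlled termwise by their weight under
   the exponent [k]; a farther [v] links back to [u] with probability at most
   [L ^- k], as at least [L ^ k] nodes are closer to [v] than [u] is. *)
Lemma reciprocity_le_below r u s (L : nat) :
  (forall v, 0 <= r v) -> s <= k%:R -> (0 < L)%N -> (2 * L <= n)%N ->
  reciprocity r u s <=
  (k%:R * L%:R) `^ (k%:R - s) * norm_const u k%:R / norm_const u s *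
    reciprocity r u k%:R + (L%:R ^+ k)^-1.
Proof.
move=> r_ge0 sk L0 Ln; set M := _ / _.
have M0 : 0 <= M by rewrite !mulr_ge0 ?powR_ge0 ?invr_ge0 ?ltW ?norm_const_gt0.
have L1 : 0 <= (L%:R ^+ k)^-1 :> R by rewrite invr_ge0 exprn_ge0 ?ler0n.
rewrite -[X in _ + X]mul1r -[X in _ + X * _](sum_link_prob k_gt0 n_ge2 u s).
rewrite mulr_suml mulr_sumr -big_split.
apply: ler_sum => v vu; have q0 := link_prob_ge0 k_gt0 n_ge2 v u (r v).
have [far|near] := ltnP (k * L) (torus_dist u v).
  apply: ler_wpDl; first by rewrite (mulr_ge0 M0) // mulr_ge0 // link_prob_ge0.
  by rewrite ler_wpM2l ?link_prob_ge0 // link_prob_far // torus_distC.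
apply: ler_wpDr; first by rewrite mulr_ge0 ?link_prob_ge0.
rewrite mulrA ler_wpM2r // /M /link_prob.
have d0 : 0 < (torus_dist u v)%:R :> R.
  by rewrite (lt_le_trans ltr01) // torus_dist_ge1.
have -> : (torus_dist u v)%:R `^ (- s) =
    (torus_dist u v)%:R `^ (k%:R - s) * (torus_dist u v)%:R `^ (- k%:R) :> R.
  by rewrite -powRD ?(gt_eqF d0) ?implybT //; congr (_ `^ _); ring.
set D := _ `^ (- k%:R); set P := _ `^ _; set Q := _ `^ _.
have ck : norm_const u k%:R != 0 :> R by rewrite gt_eqF ?norm_const_gt0.
have -> : Q * norm_const u k%:R / norm_const u s * (D / norm_const u k%:R) =
          Q * D / norm_const u s.
  rewrite -!mulrA; congr (_ * _); rewrite mulrCA [in RHS]mulrC; congr (_ * _).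
  by rewrite mulrCA mulfV // mulr1.
rewrite ler_wpM2r ?invr_ge0 ?(ltW (norm_const_gt0 _ _ _ _)) // ler_wpM2r ?powR_ge0 //.
apply: ge0_ler_powR; rewrite ?subr_ge0 ?nnegrE ?mulr_ge0 ?ler0n //.
by rewrite -natrM ler_nat.
Qed.

Lemma link_prob_ge u v (s t : R) : v != u -> (torus_dist u v <= 2)%N ->
  0 <= s <= k%:R -> t <= s ->
  (2 ^+ k)^-1 / norm_const u t <= link_prob u v s.
Proof.
move=> vu d2 /andP[s0 sk] ts; apply: ler_pM.
- by rewrite invr_ge0 exprn_ge0.
- by rewrite invr_ge0 ltW // norm_const_gt0.
- have d0 : 0 < (torus_dist u v)%:R :> R.
    by rewrite (lt_le_trans ltr01) // torus_dist_ge1.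
  rewrite powRN lef_pV2 ?posrE ?powR_gt0 ?exprn_gt0 //.
  rewrite -powR_mulrn //; apply: le_trans (_ : 2 `^ s <= _).
    by apply: ge0_ler_powR; rewrite ?nnegrE ?ler0n ?ler_nat.
  by apply: ler_powR; rewrite // ler1n.
by rewrite lef_pV2 ?posrE ?norm_const_gt0 // norm_const_anti.
Qed.

Lemma link_prob_neighbor_ge u v (s t : R) : torus_dist u v = 1%N -> t <= s ->
  (2 ^+ k)^-1 / norm_const u t <= link_prob u v s.
Proof.
move=> d1 ts; rewrite /link_prob d1 powR1; apply: ler_pM.
- by rewrite invr_ge0 exprn_ge0.
- by rewrite invr_ge0 ltW // norm_const_gt0.
- by rewrite invf_le1 ?exprn_gt0 // exprn_ege1 // ler1n.
by rewrite lef_pV2 ?posrE ?norm_const_gt0 // norm_const_anti.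
Qed.

End Payoff.

(** * Comparison of payoffs *)

Lemma natr_powR_eventually_ge (R : realType) (K e : R) : 0 < e ->
  exists n0 : nat, forall n, (n0 <= n)%N -> K <= n%:R `^ e.
Proof.
move=> e0; have M0 : 0 <= Num.max 0 K by rewrite le_max lexx.
exists (Num.bound (Num.max 0 K `^ e^-1)) => n n0n.
apply: le_trans (_ : Num.max 0 K <= _); first by rewrite le_max lexx orbT.
have -> : Num.max 0 K = (Num.max 0 K `^ e^-1) `^ e.
  by rewrite -powRrM mulVf ?lt0r_neq0 // powRr1.
apply: ge0_ler_powR; rewrite ?(ltW e0) ?nnegrE ?powR_ge0 ?ler0n //.
apply: ltW; apply: lt_le_trans (archi_boundP (powR_ge0 _ _)) _.
by rewrite ler_nat.
Qed.

(* All multiplicative constants are absorbed into the factor [n ^ e]. *)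
Definition norm_const_scaling (R : realType) (k g : nat) (e : R) (n : nat) : Prop :=
  [/\ (3 <= n)%N, 4 ^+ k <= n%:R `^ e, 2 * k%:R ^+ k <= n%:R `^ e
    & forall u : node k n,
      [/\ norm_const u k%:R <= n%:R `^ (e + e),
          norm_const u (k%:R - 1 + g%:R^-1) <= n%:R `^ (e + 1 - g%:R^-1),
          norm_const u (g%:R^-1) <= n%:R `^ (e + k%:R - g%:R^-1)
        & forall s, 0 <= s <= k%:R ->
          n%:R `^ (k%:R - s) <= n%:R `^ e * norm_const u s]].

Lemma norm_const_scaling_eventually (R : realType) (k g : nat) (e : R) :
  (0 < k)%N -> (2 <= g)%N -> 0 < e < 1 ->
  exists n0 : nat, forall n, (n0 <= n)%N -> norm_const_scaling k g e n.
Proof.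
move=> k0 g2 /andP[e0 e1].
have k1 : 1 <= k%:R :> R by rewrite ler1n.
have g0 : 0 < g%:R^-1 :> R by rewrite invr_gt0 ltr0n; lia.
have g1 : g%:R^-1 < 1 :> R by rewrite invf_lt1 ?ltr0n ?ltr1n; lia.
pose C (s : R) : R := (2 * (1 + (1 - s / k%:R)^-1)) ^+ k.
have C0 s : s < k%:R -> 0 <= C s.
  move=> sk; rewrite exprn_ge0 // mulr_ge0 // addr_ge0 // invr_ge0 subr_ge0.
  by rewrite ler_pdivrMr ?mul1r ?ltW // (lt_le_trans ltr01).
pose C3 := C (k%:R - e); pose C4 := C (k%:R - 1 + g%:R^-1); pose C5 := C g%:R^-1.
have C3_ge0 : 0 <= C3 by apply: C0; lra.
have C4_ge0 : 0 <= C4 by apply: C0; lra.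
have C5_ge0 : 0 <= C5 by apply: C0; lra.
have C1_ge0 : 0 <= 4 ^+ k :> R by rewrite exprn_ge0.
have C2_ge0 : 0 <= 2 * k%:R ^+ k :> R by rewrite mulr_ge0 // exprn_ge0 // ler0n.
have [n0 n0P] :=
  natr_powR_eventually_ge (4 ^+ k + (2 * k%:R ^+ k + (C3 + (C4 + C5)))) e0.
exists (n0 + 3)%N => n n0n; have {n0P} := n0P n (leq_trans (leq_addr _ _) n0n).
set y := n%:R `^ e => Kn.
have n3 : (3 <= n)%N := leq_trans (leq_addl _ _) n0n.
have n2 := ltnW n3.
have x0 : 0 < n%:R :> R by rewrite ltr0n ltnW.
have pD a b : (n%:R : R) `^ a * n%:R `^ b = n%:R `^ (a + b).
  by rewrite -powRD ?(gt_eqF x0) ?implybT.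
have bound (s p : R) (u : node k n) :
    0 < s < k%:R -> C s <= n%:R `^ e -> p = e + (k%:R - s) ->
    norm_const u s <= n%:R `^ p.
  move=> sk Cs ->; apply: le_trans (norm_const_le u k0 sk) _.
  by rewrite -pD ler_wpM2r // powR_ge0.
have [y1 y2 [y3 y4 y5]] : [/\ 4 ^+ k <= y, 2 * k%:R ^+ k <= y
    & [/\ C3 <= y, C4 <= y & C5 <= y]].
  move: Kn C1_ge0 C2_ge0 C3_ge0 C4_ge0 C5_ge0; clear.
  move: y C3 C4 C5 (4 ^+ k) (2 * k%:R ^+ k) => y C3 C4 C5 C1 C2 *.
  by split; [lra|lra|split; lra].
split=> //.
move=> u; split.
- apply: le_trans (norm_const_anti u (_ : k%:R - e <= k%:R)) _.
    by rewrite lerBlDr lerDl ltW.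
  by apply: bound => //; [lra|ring].
- by apply: bound => //; [lra|ring].
- by apply: bound => //; [lra|ring].
move=> s sk.
apply: le_trans (norm_const_ge u k0 n2 sk) _.
have c0 := norm_const_gt0 k0 n2 u s.
by rewrite ler_wpM2r ?(ltW c0).
Qed.

Section BestResponse.
Variables (R : realType) (k g n : nat) (e : R).
Local Notation x := n%:R.
Local Notation h := g%:R^-1.
Hypotheses (k_gt0 : (0 < k)%N) (g_ge2 : (2 <= g)%N) (e_gt0 : 0 < e).
Hypothesis scaling : norm_const_scaling k g e n.
Implicit Types (u v w : node k n) (s : R) (r : profile R k n).

Let n_ge3 : (3 <= n)%N. Proof. by have [] := scaling. Qed.
Let n_ge2 : (2 <= n)%N. Proof. exact: ltnW. Qed.
Let x_gt1 : 1 < x :> R. Proof. by rewrite ltr1n. Qed.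
Let x_gt0 : 0 < x :> R. Proof. exact: lt_trans x_gt1. Qed.
Let h_gt0 : 0 < h :> R. Proof. by rewrite invr_gt0 ltr0n (leq_trans _ g_ge2). Qed.
Let k_ge1 : 1 <= k%:R :> R. Proof. by rewrite ler1n. Qed.

Let powD (a b : R) : x `^ a * x `^ b = x `^ (a + b).
Proof. by rewrite -powRD ?(gt_eqF x_gt0) ?implybT. Qed.

Let le_pow (a b : R) : a <= b -> x `^ a <= x `^ b.
Proof. by apply: ler_powR; exact: ltW. Qed.

Let lt_pow (a b : R) : a < b -> x `^ a < x `^ b.
Proof.
move=> ab; rewrite lt_neqAle le_pow ?ltW // andbT; apply/eqP => eq_ab.
have : x `^ (b - a) == 1.
  by rewrite powRB ?(gt_eqF x_gt0) ?implybT // eq_ab divff // gt_eqF // powR_gt0.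
by rewrite powR_eq1 (gt_eqF x_gt1) (ltNge x) (ltW x_gt0) /= subr_eq0 (gt_eqF ab).
Qed.

Let powVe (a : R) : x `^ (- a) = (x `^ a)^-1.
Proof. exact: powRN. Qed.

Lemma mean_link_ge u : x `^ (1 - 3 * e) <= mean_link u k%:R.
Proof.
rewrite /mean_link mean_dist //; have [_ _ _ /(_ u)[ck _ _ lb]] := scaling.
have {}lb := lb (k%:R - 1) ltac:(by rewrite subr_ge0 k_ge1 lerBlDr lerDl ler01).
rewrite ler_pdivlMr ?norm_const_gt0 //.
apply: le_trans (ler_wpM2l (powR_ge0 _ _) ck) _.
rewrite powD -(@ler_pM2l _ (x `^ e)) ?powR_gt0 // powD.
by apply: le_trans lb; apply: le_pow; lra.
Qed.

Lemma mean_link_le_above u s : k%:R + h <= s -> mean_link u s <= x `^ (e + 1 - h).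
Proof.
move=> ks; rewrite /mean_link mean_dist //.
have [_ _ _ /(_ u)[_ + _ _]] := scaling; apply: le_trans.
have c0 (t : R) : 0 < norm_const u t by exact: norm_const_gt0.
rewrite ler_pdivrMr // -[leLHS]mulr1; apply: ler_pM => //; first exact: ltW.
  by apply: norm_const_anti; lra.
exact: norm_const_ge1.
Qed.

Lemma mean_link_le_below u s : mean_link u s <= x `^ (1 + e).
Proof.
apply: le_trans (mean_dist_le k_gt0 n_ge2 u s) _.
rewrite -powD powRr1 ?(ltW x_gt0) // [leLHS]mulrC.
apply: ler_wpM2l; first exact: ltW.
have [_ _ + _] := scaling; apply: le_trans.
have : k%:R ^+ 1 <= k%:R ^+ k :> R by rewrite ler_weXn2l.
by rewrite expr1; have k1 := k_ge1; lra.
Qed.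

Lemma payoff_lt_above (alpha : node k n -> R) r u s :
  2 * e < (h - 4 * e) * alpha u -> 0 <= alpha u -> k%:R + h <= s ->
  payoff alpha r u s < payoff alpha r u k%:R.
Proof.
move=> e_small a0 ks; rewrite /payoff -!/(mean_link _ _) -!/(reciprocity _ _ _).
have H0 := reciprocity_gt0 k_gt0 n_ge2 r u k%:R.
have mean_ge0 (t : R) : 0 <= mean_link u t.
  by apply: sumr_ge0 => v _; rewrite mulr_ge0 ?ler0n ?link_prob_ge0.
apply: lt_le_trans
  (_ : x `^ ((1 - 3 * e) * alpha u) * reciprocity r u k%:R <= _); last first.
  rewrite ler_wpM2r ?(ltW H0) // powRrM.
  by apply: ge0_ler_powR; rewrite ?nnegrE ?powR_ge0 ?mean_ge0 ?mean_link_ge.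
have hit : reciprocity r u s <= x `^ (e + e) * reciprocity r u k%:R.
  have {}ks : k%:R <= s by have h0 := h_gt0; lra.
  apply: le_trans (reciprocity_le_above k_gt0 n_ge2 r u ks) _.
  by rewrite ler_wpM2r ?(ltW H0) //; have [_ _ _ /(_ u)[]] := scaling.
apply: le_lt_trans (_ : x `^ ((e + 1 - h) * alpha u) *
    (x `^ (e + e) * reciprocity r u k%:R) < _).
  apply: ler_pM; rewrite ?powR_ge0 ?(ltW (reciprocity_gt0 _ _ _ _ _)) // powRrM.
  by apply: ge0_ler_powR; rewrite ?nnegrE ?powR_ge0 ?mean_ge0 ?mean_link_le_above.
by rewrite mulrA ltr_pM2r // powD lt_pow //; lra.
Qed.

Lemma reciprocity_lt_below r u v s (d : R) :
  (forall w, 0 <= r w) -> 0 <= s -> s <= k%:R - h ->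
  e <= d -> d <= 1 -> d * (k%:R + h) <= h ->
  v != u -> (torus_dist u v <= 2)%N ->
  (2 ^+ k)^-1 / norm_const v h <= link_prob v u (r v) ->
  reciprocity r u s <= x `^ (6 * e - d * h) * reciprocity r u k%:R.
Proof.
move=> r0 s0 sk ed d1 dk vu d2 qv.
have h0 := h_gt0; have k1 := k_ge1; have e0 := e_gt0.
have [_ y4 yk scal] := scaling.
have H0 := reciprocity_gt0 k_gt0 n_ge2 r u k%:R.
have z1 : 1 <= x `^ (1 - d) by rewrite -[leLHS](powRr0 x) le_pow // subr_ge0.
pose L := Num.truncn (x `^ (1 - d)).
have /andP[Lle Lgt] := truncn_itv (powR_ge0 x (1 - d)); rewrite -/L in Lle Lgt.
have L0 : (0 < L)%N by rewrite /L truncn_gt0.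
clearbody L.
have y2 : 2 <= x `^ e.
  apply: le_trans y4; apply: le_trans (_ : 4 ^+ 1 <= _); first by rewrite expr1 ler_nat.
  by rewrite ler_eXn2l ?ltr1n.
have Ln : (2 * L <= n)%N.
  rewrite -(ler_nat R) natrM.
  apply: le_trans (_ : x `^ e * x `^ (1 - d) <= _); first by apply: ler_pM.
  by rewrite powD -[leRHS]powRr1 ?le_pow //; lra.
apply: le_trans (reciprocity_le_below k_gt0 n_ge2 u r0 _ L0 Ln) _; first by lra.
have [ck _ _ /(_ s)] := scal u; rewrite s0 /= => /(_ ltac:(lra)) cs.
have [_ _ ch _] := scal v.
have cs0 := norm_const_gt0 k_gt0 n_ge2 u s.
have near : (k%:R * L%:R) `^ (k%:R - s) * norm_const u k%:R / norm_const u s <=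
    x `^ (5 * e - d * h).
  rewrite ler_pdivrMr // powRM ?ler0n //.
  apply: le_trans (_ : x `^ e * x `^ ((1 - d) * (k%:R - s)) * x `^ (e + e) <= _).
    apply: ler_pM; rewrite ?mulr_ge0 ?powR_ge0 ?(ltW (norm_const_gt0 _ _ _ _)) //.
    apply: ler_pM; rewrite ?powR_ge0 //.
      apply: le_trans (_ : k%:R `^ k%:R <= _); first by apply: ler_powR => //; lra.
      rewrite (powR_mulrn k (ler0n R k)); apply: le_trans yk.
      by rewrite ler_peMl ?exprn_ge0 ?ler0n // ler1n.
    by rewrite powRrM; apply: ge0_ler_powR; rewrite ?nnegrE ?ler0n ?powR_ge0 //; lra.
  apply: le_trans (_ : x `^ (4 * e - d * h) * x `^ (k%:R - s) <= _).
    by rewrite !powD; apply: le_pow; nra.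
  have -> : 5 * e - d * h = (4 * e - d * h) + e by ring.
  by rewrite -[in leRHS]powD -mulrA ler_wpM2l ?powR_ge0.
have far : (L%:R ^+ k)^-1 <= x `^ (5 * e - d * h) * reciprocity r u k%:R.
  have Lk : (L%:R ^+ k)^-1 <= 2 ^+ k * x `^ ((d - 1) * k%:R).
    rewrite powRrM (powR_mulrn k (powR_ge0 _ _)) -exprMn -exprVn lerXn2r ?nnegrE //.
    - by rewrite invr_ge0 ler0n.
    - by rewrite mulr_ge0 ?powR_ge0.
    have -> : d - 1 = - (1 - d) by ring.
    rewrite powRN ler_pdivlMr ?powR_gt0 // mulrC ler_pdivrMr ?ltr0n //.
    apply: le_trans (ltW Lgt) _; rewrite -natrM ler_nat; clear -L0; lia.
  have ge_hit :
      (2 ^+ k)^-1 / x `^ (e + e) * ((2 ^+ k)^-1 / x `^ (e + k%:R - h)) <=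
      reciprocity r u k%:R.
    apply: le_trans (reciprocity_ge_link k_gt0 n_ge2 r k%:R vu).
    apply: ler_pM; rewrite ?mulr_ge0 ?invr_ge0 ?exprn_ge0 ?powR_ge0 //.
      apply: (le_trans _ (link_prob_ge (t := k%:R) k_gt0 n_ge2 vu d2 _ (lexx _))).
        rewrite ler_wpM2l ?invr_ge0 ?exprn_ge0 //.
        by rewrite lef_pV2 ?posrE ?powR_gt0 ?norm_const_gt0.
      by rewrite lexx ler0n.
    apply: le_trans qv.
    rewrite ler_wpM2l ?invr_ge0 ?exprn_ge0 //.
    by rewrite lef_pV2 ?posrE ?powR_gt0 ?norm_const_gt0.
  apply: le_trans (ler_wpM2l (powR_ge0 _ _) ge_hit).
  apply: le_trans Lk _.
  have two0 : 0 < 2 ^+ k :> R by rewrite exprn_gt0.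
  have -> : x `^ (5 * e - d * h) *
      ((2 ^+ k)^-1 / x `^ (e + e) * ((2 ^+ k)^-1 / x `^ (e + k%:R - h))) =
      (2 ^+ k * 2 ^+ k)^-1 * x `^ (2 * e - d * h - k%:R + h).
    have -> : 2 * e - d * h - k%:R + h =
        5 * e - d * h + - (e + e) + - (e + k%:R - h) by ring.
    move: (5 * e - d * h) (e + e) (e + k%:R - h) => p q q'.
    by rewrite -!powD !powVe invfM; ring.
  rewrite ler_pdivlMl ?mulr_gt0 //.
  have two4 : 2 ^+ k * 2 ^+ k = 4 ^+ k :> R.
    by rewrite -exprMn; congr (_ ^+ _); ring.
  have y8 : 2 ^+ k * 2 ^+ k * 2 ^+ k <= x `^ (e + e).
    rewrite two4 -powD; apply: ler_pM => //; try exact: ltW; first exact: exprn_ge0.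
    apply: le_trans y4; rewrite -two4 -[leLHS]mulr1.
    by apply: ler_wpM2l; [exact: ltW | rewrite exprn_ege1 // ler1n].
  rewrite !mulrA; apply: le_trans (ler_wpM2r (powR_ge0 _ _) y8) _.
  by rewrite powD; apply: le_pow; nra.
apply: le_trans (lerD (ler_wpM2r (ltW H0) near) far) _.
have -> : 6 * e - d * h = e + (5 * e - d * h) by ring.
rewrite -[in leRHS]powD -mulrA; set A := _ * reciprocity _ _ _.
have A0 : 0 <= A by rewrite mulr_ge0 ?powR_ge0 ?(ltW H0).
by rewrite (_ : A + A = 2 * A); [rewrite ler_wpM2r | ring].
Qed.

Lemma payoff_lt_below (alpha : node k n -> R) r u v s (d : R) :
  (forall w, 0 <= r w) -> 0 <= s -> s <= k%:R - h ->
  e <= d -> d <= 1 -> d * (k%:R + h) <= h ->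
  0 <= alpha u -> (4 * alpha u + 6) * e < d * h ->
  v != u -> (torus_dist u v <= 2)%N ->
  (2 ^+ k)^-1 / norm_const v h <= link_prob v u (r v) ->
  payoff alpha r u s < payoff alpha r u k%:R.
Proof.
move=> r0 s0 sk ed d1 dk a0 ea vu d2 qv.
rewrite /payoff -!/(mean_link _ _) -!/(reciprocity _ _ _).
have H0 := reciprocity_gt0 k_gt0 n_ge2 r u k%:R.
have mean_ge0 (t : R) : 0 <= mean_link u t.
  by apply: sumr_ge0 => w _; rewrite mulr_ge0 ?ler0n ?link_prob_ge0.
apply: lt_le_trans
  (_ : x `^ ((1 - 3 * e) * alpha u) * reciprocity r u k%:R <= _); last first.
  rewrite ler_wpM2r ?(ltW H0) // powRrM.
  by apply: ge0_ler_powR; rewrite ?nnegrE ?powR_ge0 ?mean_ge0 ?mean_link_ge.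
apply: le_lt_trans (_ : x `^ ((1 + e) * alpha u) *
    (x `^ (6 * e - d * h) * reciprocity r u k%:R) < _).
  apply: ler_pM; rewrite ?powR_ge0 ?(ltW (reciprocity_gt0 _ _ _ _ _)) //.
    rewrite powRrM.
    by apply: ge0_ler_powR; rewrite ?nnegrE ?powR_ge0 ?mean_ge0 ?mean_link_le_below.
  exact: (reciprocity_lt_below r0 s0 sk ed d1 dk vu d2 qv).
by rewrite mulrA ltr_pM2r // powD lt_pow //; lra.
Qed.

End BestResponse.

(** * Best response dynamics *)

Section Strategies.
Variables (R : realType) (g : nat).
Hypothesis g_ge2 : (2 <= g)%N.
Implicit Types s : R.

Let g_gt0 : 0 < g%:R :> R. Proof. by rewrite ltr0n ltnW. Qed.

Lemma strategies_natr (m : nat) : strategies g (m%:R : R).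
Proof. by exists (m * g)%N => //=; rewrite natrM mulfK // gt_eqF. Qed.

Lemma strategies_ge0 s : strategies g s -> 0 <= s.
Proof. by move=> [m _ <-]; rewrite divr_ge0 ?ler0n. Qed.

Lemma strategies_gap s (m : nat) : strategies g s -> m%:R < s -> m%:R + g%:R^-1 <= s.
Proof.
move=> [p _ <-]; rewrite ltr_pdivlMr // -natrM ltr_nat => mp.
rewrite ler_pdivlMr // mulrDl mulVf ?gt_eqF // -natrM natr1 ler_nat //.
Qed.

Lemma strategies_gap_below s (m : nat) :
  strategies g s -> s < m%:R -> s <= m%:R - g%:R^-1.
Proof.
move=> [p _ <-]; rewrite ltr_pdivrMr // -natrM ltr_nat => mp.
rewrite ler_pdivrMr // mulrBl mulVf ?gt_eqF // -natrM lerBrDr natr1 ler_nat //.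
Qed.

End Strategies.

Section Dynamics.
Variables (R : realType) (k g n : nat) (alpha : node k n -> R).
Local Notation h := g%:R^-1.
Hypotheses (k_gt0 : (0 < k)%N) (g_ge2 : (2 <= g)%N) (n_ge4 : (4 <= n)%N).
Hypothesis lt_above : forall (r : profile R k n) u s,
  k%:R + h <= s -> payoff alpha r u s < payoff alpha r u k%:R.
Hypothesis lt_below : forall (r : profile R k n) u v s,
  (forall w, 0 <= r w) -> 0 <= s -> s <= k%:R - h ->
  v != u -> (torus_dist u v <= 2)%N ->
  (2 ^+ k)^-1 / norm_const v h <= link_prob v u (r v) ->
  payoff alpha r u s < payoff alpha r u k%:R.
Implicit Types (u v w : node k n) (s : R) (r : profile R k n).

Let n_ge2 : (2 <= n)%N. Proof. exact: leq_trans n_ge4. Qed.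

Lemma ex_best_response r u : exists s, best_response g alpha r u s.
Proof.
pose F (i : 'I_(k * g).+1) := payoff alpha r u (i%:R * h).
have [i _ iP] := @arg_maxP _ _ 'I_(k * g).+1 ord0 predT F isT.
exists (i%:R * h); split; first by exists i.
move=> _ [m _ <-]; have [mk|km] := leqP m (k * g).
  exact: (iP (Ordinal (mk : (m < (k * g).+1)%N))).
have g_gt0 : 0 < g%:R :> R by rewrite ltr0n ltnW.
have -> : payoff alpha r u (i%:R * h) = F i by [].
apply: le_trans (_ : payoff alpha r u k%:R <= _); last first.
  have -> : k%:R = (k * g)%N%:R * h :> R by rewrite natrM mulfK // gt_eqF.
  exact: (iP ord_max).
apply/ltW/lt_above/strategies_gap => //; first by exists m.
by rewrite ltr_pdivlMr // -natrM ltr_nat.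
Qed.

Definition activated r u : Prop := exists2 v, v != u &
  (torus_dist u v = 1%N /\ r v != 0) \/ ((torus_dist u v <= 2)%N /\ r v = k%:R).

Lemma best_response_activated r u : (forall w, strategies g (r w)) ->
  activated r u -> forall s, best_response g alpha r u s <-> s = k%:R.
Proof.
move=> rS [v vu act].
have g_gt0 : 0 < g%:R :> R by rewrite ltr0n ltnW.
have r_ge0 w : 0 <= r w by exact: strategies_ge0 (rS w).
have h_le1 : h <= 1 :> R by rewrite invf_le1 // ler1n ltnW.
have link_v : (2 ^+ k)^-1 / norm_const v h <= link_prob v u (r v) :> R.
  case: act => [[d1 rv]|[d2 ->]].
    apply: link_prob_neighbor_ge => //; first by rewrite torus_distC.
    rewrite -[leLHS]add0r (@strategies_gap _ _ _ _ 0) //.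
    by rewrite lt_neqAle eq_sym rv r_ge0.
  apply: link_prob_ge; rewrite // 1?eq_sym 1?torus_distC //.
    by rewrite lexx ler0n.
  by apply: le_trans h_le1 _; rewrite ler1n.
have d2 : (torus_dist u v <= 2)%N by case: act => [[->]|[]].
have lt_k s : strategies g s -> s != k%:R -> payoff alpha r u s < payoff alpha r u k%:R.
  move=> sS; rewrite neq_lt => /orP[sk|ks].
    apply: (lt_below r_ge0 _ _ vu d2 link_v); first exact: strategies_ge0 sS.
    exact: strategies_gap_below.
  by apply: lt_above; exact: strategies_gap.
move=> s; split=> [[sS s_max]|->]; last first.
  split=> [|s' s'S]; first exact: strategies_natr.
  by have [->//|/lt_k] := eqVneq s' k%:R; move/(_ s'S)/ltW.
apply/eqP/negPn/negP => /(lt_k _ sS); rewrite ltNge s_max //.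
exact: strategies_natr.
Qed.

Lemma ex_sync_dynamics r : exists s : nat -> profile R k n, sync_dynamics g alpha r s.
Proof.
have [f fP] := boolp.choice (fun ru : profile R k n * node k n =>
  ex_best_response ru.1 ru.2).
pose next r' : profile R k n := [ffun u => f (r', u)].
exists (fun t => iter t next r); split=> // t u; rewrite /next ffunE.
exact: (fP (_, u)).
Qed.

Lemma torus_dist_neq u v : (0 < torus_dist u v)%N -> v != u.
Proof. by apply: contraTneq => ->; rewrite torus_distxx. Qed.

Lemma sync_dynamics_converges r (s : nat -> profile R k n) :
  (forall u, strategies g (r u)) -> r != const_profile k n 0 ->
  sync_dynamics g alpha r s ->
  converges_within s (const_profile k n k%:R) (k * n./2).
Proof.
move=> rS r0 [s0 s_step].
have [v rv] : exists v, r v != 0.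
  apply/existsP; apply: contraNT r0; rewrite negb_exists => /forallP r0.
  by apply/eqP/ffunP => u; rewrite ffunE; apply/eqP; rewrite -[_ == _]negbK r0.
have sS t u : strategies g (s t u).
  by case: t => [|t]; [rewrite s0|have [] := s_step t u].
have to_k t u : activated (s t) u -> s t.+1 u = k%:R.
  by move=> act; apply/(best_response_activated (sS t) act)/s_step.
have ball t : forall w,
    w != v \/ (0 < t)%N -> (torus_dist v w <= t.+1)%N -> s t.+1 w = k%:R.
  elim: t => [|t IHt] w.
    case=> // wv; have := torus_dist_gt0 wv; rewrite torus_distC => d0 d1.
    apply: to_k; exists v; first by rewrite eq_sym.
    by left; rewrite s0; split=> //; rewrite torus_distC; lia.
  move=> _ dw; apply: to_k; have [->|wv] := eqVneq w v.
    have [v' vv'] := ex_neighbor k_gt0 v n_ge2.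
    have v'v : v' != v by apply: torus_dist_neq; rewrite vv'.
    exists v' => //; right; split; first by rewrite vv'.
    by apply: IHt; [left|rewrite vv'].
  have [w' ww' vw'] := torus_dist_step wv.
  have [w'v|w'v] := eqVneq w' v.
    have [w'' [w''w vw'' ww'']] := ex_other_neighbor k_gt0 w v (ltnW n_ge4).
    exists w'' => //; right; split; first by rewrite -w'v ww' in ww''.
    by apply: IHt; [left; apply: torus_dist_neq|]; rewrite vw''.
  exists w'; first by apply: torus_dist_neq; rewrite ww'.
  right; split; first by rewrite ww'.
  by apply: IHt; [left|rewrite -ltnS vw'].
exists (k * n./2)%N => // t' le_t'; apply/ffunP => w; rewrite ffunE.
have n2 : (2 <= k * n./2)%N.
  have n42 : (2 <= n./2)%N by lia.
  exact: leq_trans n42 (leq_pmull _ _).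
case: t' le_t' => [|t'] le_t'; first by lia.
by apply: ball; [right; lia|apply: leq_trans (torus_dist_le v w) _].
Qed.

Lemma reachable_const r : (forall u, strategies g (r u)) ->
  r != const_profile k n 0 -> reachable g alpha r (const_profile k n k%:R).
Proof.
move=> rS r0; have [v rv] : exists v, r v != 0.
  apply/existsP; apply: contraNT r0; rewrite negb_exists => /forallP r0.
  by apply/eqP/ffunP => u; rewrite ffunE; apply/eqP; rewrite -[_ == _]negbK r0.
have [m] := ubnP #|[pred w | (w != v) && (r w != k%:R)]|.
elim: m r rS rv {r0} => // m IHm r rS rv; rewrite ltnS => card_r.
have [w0 /andP[w0v rw0]|all_k] :=
  pickP [pred w | (w != v) && (r w != k%:R)]; last first.
  have [v' vv'] := ex_neighbor k_gt0 v n_ge2.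
  have v'v : v' != v by apply: torus_dist_neq; rewrite vv'.
  have rk w : w != v -> r w = k%:R.
    by move=> wv; apply/eqP; have := all_k w; rewrite /= wv /= => /negbFE.
  apply: rt_step; exists v; split; last by move=> w /rk ->; rewrite ffunE.
  rewrite ffunE; apply/best_response_activated => //.
  by exists v' => //; right; rewrite vv' rk.
have [w /andP[wv rw] w_min] := @arg_minnP _ w0
  [pred w | (w != v) && (r w != k%:R)] (torus_dist v) (introT andP (conj w0v rw0)).
pose r1 : profile R k n := [ffun u => if u == w then k%:R else r u].
apply: rt_trans (_ : reachable g alpha r1 _).
  apply: rt_step; exists w; split; last by move=> u /negbTE uw; rewrite ffunE uw.
  rewrite ffunE eqxx; apply/best_response_activated => //.
  have [w' ww' vw'] := torus_dist_step wv.
  have w'w : w' != w by apply: torus_dist_neq; rewrite ww'.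
  exists w' => //; have [w'v|w'v] := eqVneq w' v; first by left; rewrite ww' w'v.
  right; rewrite ww'; split=> //; apply/eqP/negPn/negP => rw'.
  by have := w_min w'; rewrite /= w'v rw' => /(_ isT); lia.
apply: IHm.
- by move=> u; rewrite ffunE; case: ifP => // _; exact: strategies_natr.
- by rewrite ffunE [v == w]eq_sym (negbTE wv).
apply: leq_trans card_r; apply/proper_card/properP; split.
  apply/fintype.subsetP => u; rewrite !inE ffunE; case: (u =P w) => // _.
  by rewrite eqxx andbF.
by exists w; rewrite !inE ?wv //= ffunE eqxx eqxx.
Qed.

End Dynamics.

(* The exponents alpha u are constants, i.e. they stay in a fixed compact
   subinterval [a, b] of the positive reals while n grows. *)
Theorem theorem3p5 (R : realType) (k g : nat) (a b : R)
    (hk : (1 <= k)%N) (hg : (2 <= g)%N) (ha : 0 < a) :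
  exists n0 : nat, forall n : nat, (2 <= n)%N -> (n0 <= n)%N ->
  forall alpha : node k n -> R, (forall u, a <= alpha u <= b) ->
  forall r0 : profile R k n,
    (forall u, strategies g (r0 u)) -> r0 != const_profile k n 0 ->
    reachable g alpha r0 (const_profile k n k%:R) /\
    (exists s : nat -> profile R k n, sync_dynamics g alpha r0 s) /\
    (forall s : nat -> profile R k n, sync_dynamics g alpha r0 s ->
       converges_within s (const_profile k n k%:R) (k * n./2)).
Proof.
have g_gt0 : 0 < g%:R :> R by rewrite ltr0n ltnW.
pose h : R := g%:R^-1; have h_gt0 : 0 < h by rewrite invr_gt0.
have h_le : h <= 1 / 2 by rewrite mul1r lef_pV2 ?posrE ?ler_nat.
have k_ge1 : 1 <= k%:R :> R by rewrite ler1n.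
pose B := Num.max a b; have aB : a <= B by rewrite le_max lexx.
pose d := h / (2 * k%:R).
have d_gt0 : 0 < d by rewrite divr_gt0 // mulr_gt0 // (lt_le_trans ltr01).
have dk : 2 * (d * k%:R) = h.
  by rewrite /d; field; rewrite gt_eqF // (lt_le_trans ltr01).
pose e := Num.min (d * h / (16 * (1 + B))) (a * (d * h) / 16).
have dh_gt0 : 0 < d * h by exact: mulr_gt0.
have B1_gt0 : 0 < 16 * (1 + B) by lra.
have e_gt0 : 0 < e.
  by rewrite lt_min; apply/andP; split; apply: divr_gt0 => //; exact: mulr_gt0.
have eB : e * (16 * (1 + B)) <= d * h by rewrite -ler_pdivlMr // ge_min lexx.
have ea : e * 16 <= a * (d * h) by rewrite -ler_pdivlMr // ge_min lexx orbT.
have d_le : d <= 1 / 4 by nra.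
have dh_le : d * h <= d / 2 by nra.
have dh_le' : d * h <= h / 4 by nra.
have e16 : e * 16 <= d * h by nra.
have e_lt1 : 0 < e < 1 by rewrite e_gt0 /=; lra.
have [n0 scaling] := norm_const_scaling_eventually hk hg e_lt1.
exists (n0 + 4)%N => n n2 n0n alpha alphaP.
have {}scaling := scaling n (leq_trans (leq_addr _ _) n0n).
have n4 : (4 <= n)%N := leq_trans (leq_addl _ _) n0n.
have alpha_ge0 u : 0 <= alpha u.
  by have /andP[+ _] := alphaP u; apply: le_trans; exact: ltW.
have alpha_leB u : alpha u <= B.
  by rewrite le_max; have /andP[_ ->] := alphaP u; rewrite orbT.
have lt_above (r : profile R k n) u s : k%:R + g%:R^-1 <= s ->
    payoff alpha r u s < payoff alpha r u k%:R.
  apply: (payoff_lt_above hk hg scaling) => //; rewrite -/h.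
  have /andP[a_le _] := alphaP u.
  apply: lt_le_trans (_ : (h - 4 * e) * a <= _).
    by have := ler_wpM2l (ltW ha) e16; have := ler_wpM2l (ltW ha) dh_le'; lra.
  by rewrite ler_wpM2l //; lra.
have lt_below (r : profile R k n) u v s :
    (forall w, 0 <= r w) -> 0 <= s -> s <= k%:R - g%:R^-1 ->
    v != u -> (torus_dist u v <= 2)%N ->
    (2 ^+ k)^-1 / norm_const v g%:R^-1 <= link_prob v u (r v) ->
    payoff alpha r u s < payoff alpha r u k%:R.
  move=> r_ge0 s_ge0 sk vu d2.
  apply: (payoff_lt_below (d := d) hk hg e_gt0 scaling) => //; rewrite -/h;
    [lra|lra|nra|].
  by have := alpha_leB u; have := alpha_ge0 u; nra.
move=> r0 r0S r0_neq0; split; first exact: reachable_const.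
split; first exact: ex_sync_dynamics.
by move=> s; exact: sync_dynamics_converges.
Qed.
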